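(* Let $G$ be a first countable locally compact group and let $a\in G$. Then the following are equivalent: (1) $a$ is an aperiodic element of $G$. (2) For any compact subset $K$ of $G$, there exists $N\in\mathbb{N}$ such that $K\cap Ka^n=\varnothing$ for all $n>N$.
   Context: Topological groups are not assumed Hausdorff; a locally compact group is a topological group whose topology is locally compact, and ''compact'' means that every open cover has a finite subcover. For $a\in G$ let $G(a)=\overline{\langle a\rangle}$ be the closure of the cyclic subgroup generated by $a$. The element $a$ is periodic if $G(a)$ is compact, and aperiodic if it is not periodic. *)

(* Defs.v *)
From HB Require Import structures.
From mathcomp Require Import all_boot.
From mathcomp Require Import all_classical.
From mathcomp Require Import topology.

Set Implicit Arguments.
Unset Strict Implicit.
Unset Printing Implicit Defensive.

Local Open Scope classical_set_scope.
Local Open Scope group_scope.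

HB.structure Definition PreTopologicalGroup :=
  {G of Topological G & Group G}.

(* No separation axiom is included: a topological group need not be
   Hausdorff. *)
HB.mixin Record PreTopologicalGroup_isTopologicalGroup G
    & PreTopologicalGroup G := {
  mulg_continuous : continuous (fun p : G * G => p.1 * p.2) ;
  invg_continuous : continuous (fun x : G => x^-1)
}.

#[short(type="topologicalGroupType")]
HB.structure Definition TopologicalGroup :=
  {G of PreTopologicalGroup G & PreTopologicalGroup_isTopologicalGroup G}.

Bind Scope group_scope with TopologicalGroup.sort.

Definition first_countable (T : topologicalType) :=
  forall x : T, exists B : set_system T, [/\
    countable B,
    B `<=` nbhs x &
    forall U, nbhs x U -> exists2 V, B V & V `<=` U].

Definition cyclic_subgroup (G : groupType) (a : G) : set G :=
  [set x | exists n : nat, x = a ^+ n \/ x = a ^- n].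

Definition closed_cyclic_subgroup (G : topologicalGroupType) (a : G) : set G :=
  closure (cyclic_subgroup a).

Definition periodic (G : topologicalGroupType) (a : G) :=
  compact (closed_cyclic_subgroup a).

Definition aperiodic (G : topologicalGroupType) (a : G) := ~ periodic a.

Lemma topologicalGroup_regular (G : topologicalGroupType) : regular_space G.
Proof.
move=> x U Ux.
have: nbhs ((1, x) : G * G) ((fun p : G * G => p.1 * p.2) @^-1` U).
  by apply: mulg_continuous; rewrite /= mul1g.
case=> -[/= W V] [W1 Vx] WVU; exists V => // y clVy.
have ctsy : (fun z : G => y * z^-1) @ y --> (y * y^-1 : G).
  have pairy : (fun z : G => (y, z^-1)) @ y --> ((y, y^-1) : G * G).
    by apply: cvg_pair; [exact: cvg_cst|exact: invg_continuous].
  exact: cvg_trans (cvg_app (fun p : G * G => p.1 * p.2) pairy)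
    (@mulg_continuous G (y, y^-1)).
have : nbhs y ((fun z : G => y * z^-1) @^-1` W).
  by apply: ctsy; rewrite mulgV.
move=> /clVy[v [Vv /= Wv]].
by have := WVU (y * v^-1, v) (conj Wv Vv); rewrite /= mulgVK.
Qed.

(* [locally_compact] asks for closed compact neighbourhoods; on a topological
   group this is the same as asking for compact neighbourhoods. *)
Lemma topologicalGroup_locally_compactP (G : topologicalGroupType) :
  locally_compact [set: G] <-> forall x : G, exists2 K, nbhs x K & compact K.
Proof.
split=> [lcG x|lcG x _].
  have [K Kx [cK _]] := lcG x I; exists K => //.
  by move: Kx; rewrite withinET.
have [K Kx cK] := lcG x.
have [V Vx VK] := topologicalGroup_regular Kx.
exists (closure V); last first.
  split; last exact: closed_closure.
  by apply: subclosed_compact cK VK; exact: closed_closure.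
rewrite withinET; apply: filterS Vx; exact: subset_closure.
Qed.

(* [compact] is defined with filters; it is the open-cover property. *)
Lemma topologicalGroup_compact_cover (G : topologicalGroupType) :
  @compact G = @cover_compact G.
Proof.
pose pG : ptopologicalType := HB.pack (TopologicalGroup.sort G) (isPointed.Build G 1).
exact: (@compact_cover pG).
Qed.

(* Main.v *)
Require Import Defs.
From mathcomp Require Import all_boot.
From mathcomp Require Import all_classical.
From mathcomp Require Import topology.

(** If [K] meets [K a^n] for infinitely many [n], then infinitely many powers
    of [a] lie in the compact set [K^-1 K]; a cluster point shows that [a^n]
    returns to every neighbourhood of [1] for arbitrarily large [n].  Let [W] be
    a compact neighbourhood of [1] with interior [U], and let [C] be the closure
    of the group generated by [a].  By recurrence every [c] in [C] satisfies
    [a^-n c \in U] and [a^i c \in U] for some [n], [i > 0].  By compactness [i]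
    may be chosen below a uniform bound [N] when [c] ranges over [C `&` W], so
    the least [n] with [a^-n c \in U] is at most [N]: otherwise replace [n] by
    [n - i].  Hence [C] is covered by the compact sets [a^n W] with [n <= N],
    and [a] is periodic. *)

Local Open Scope classical_set_scope.
Local Open Scope group_scope.

Section TopologicalGroup.
Variable G : topologicalGroupType.
Implicit Types (a c x y : G) (K L U V : set G).

Lemma cvgMg (T : Type) (F : set_system T) {FF : Filter F} (f g : T -> G) x y :
  f @ F --> x -> g @ F --> y -> (fun t => f t * g t) @ F --> x * y.
Proof.
move=> fx gy; apply: (continuous2_cvg _ (h := fun x y : G => x * y) _ fx gy).
exact: (@mulg_continuous G (x, y)).
Qed.

Lemma cvgVg (T : Type) (F : set_system T) {FF : Filter F} (f : T -> G) x :
  f @ F --> x -> (fun t => (f t)^-1) @ F --> x^-1.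
Proof. by move=> fx; apply: (cvg_comp _ _ fx); exact: invg_continuous. Qed.

Lemma mulgl_continuous x : continuous (fun y : G => x * y).
Proof. by move=> y; apply: cvgMg; [exact: cvg_cst|exact: cvg_id]. Qed.

Lemma mulgr_continuous x : continuous (fun y : G => y * x).
Proof. by move=> y; apply: cvgMg; [exact: cvg_id|exact: cvg_cst]. Qed.

Lemma mulVg_continuous : continuous (fun p : G * G => p.1^-1 * p.2).
Proof.
move=> [x y]; apply: cvgMg; last exact: cvg_snd.
by apply: cvgVg; exact: cvg_fst.
Qed.

Lemma compact_mulVg K : compact K ->
  compact [set p.1^-1 * p.2 | p in K `*` K].
Proof.
move=> cK; apply: continuous_compact; last exact: compact_setX.
by apply: continuous_subspaceT; exact: mulVg_continuous.
Qed.

Definition recurrent a :=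
  forall V, nbhs 1 V -> forall N : nat, exists2 n, (N < n)%N & V (a ^+ n).

Lemma compact_frequently_recurrent L a : compact L ->
  (forall N : nat, exists2 n, (N < n)%N & L (a ^+ n)) -> recurrent a.
Proof.
move=> cL freqL V V1 N.
(* [F] consists of the sets that contain all late powers of [a] lying in [L]; it is proper because
   such powers never run out. *)
pose F : set_system G := [set A | exists M : nat,
  forall n, (M < n)%N -> L (a ^+ n) -> A (a ^+ n)].
have FF : ProperFilter F.
  apply: Build_ProperFilter_ex => [A [M FA]|].
    by have [n Mn Ln] := freqL M; exists (a ^+ n); exact: FA.
  split=> [|A B [M MA] [M' MB]|A B AB [M MA]].
  - by exists 0%N.
  - exists (maxn M M') => n; rewrite gtn_max => /andP[Mn M'n] Ln.
    by split; [exact: MA|exact: MB].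
  - by exists M => n Mn Ln; apply/AB/MA.
have [x [_ clx]] : L `&` cluster F !=set0 by apply: cL; exists 0%N.
have : nbhs (x, x) ((fun p : G * G => p.1^-1 * p.2) @^-1` V).
  by apply: mulVg_continuous; rewrite /= mulVg.
case=> -[/= B B'] [Bx B'x] BB'V.
have visit C M : nbhs x C -> exists2 n, (M < n)%N & C (a ^+ n).
  move=> Cx; have [] := clx [set y | exists2 n, (M < n)%N & y = a ^+ n] C.
  - by exists M => n Mn _; exists n.
  - exact: Cx.
  - by move=> _ [[n Mn ->] Cn]; exists n.
(* Both powers are close to [x], so [a ^- m * a ^+ n] is in [V]; taking [n] beyond [m + N] makes the
   exponent [n - m] exceed [N]. *)
have [m _ Bm] := visit _ 0%N Bx; have [n mNn B'n] := visit _ (m + N)%N B'x.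
exists (n - m)%N; first by rewrite ltn_subRL.
have mn : (m <= n)%N by rewrite (leq_trans _ (ltnW mNn)) ?leq_addr.
have := BB'V (a ^+ m, a ^+ n) (conj Bm B'n).
by rewrite /= -{1}(subnKC mn) expgnDr mulKg.
Qed.

(** Dividing by [x], a power of exponent [k] or [-k], moves exponents by [k], so large ones keep
    their sign. *)
Lemma cyclic_subgroup_shift a x : cyclic_subgroup a x ->
  exists k : nat, forall m, (k <= m)%N ->
    (exists2 j, (m - k <= j)%N & a ^+ m * x^-1 = a ^+ j) /\
    (exists2 j, (m - k <= j)%N & a ^- m * x^-1 = a ^- j).
Proof.
case=> k [] ->; exists k => m km; split.
- by exists (m - k)%N; rewrite ?expgnFr.
- exists (k + m)%N; last by rewrite expgnDr invgM.
  by rewrite (leq_trans (leq_subr _ _)) ?leq_addl.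
- exists (m + k)%N; last by rewrite expgnDr invgK.
  by rewrite (leq_trans (leq_subr _ _)) ?leq_addr.
- exists (m - k)%N => //; rewrite invgK -{1}(subnKC km) expgnDr invgM.
  by rewrite mulgVK.
Qed.

Lemma cyclic_subgroup_mulVX a x (n : nat) :
  cyclic_subgroup a x -> cyclic_subgroup a (a ^- n * x).
Proof.
case=> k [] ->; last by exists (k + n)%N; right; rewrite expgnDr invgM.
have [nk|/ltnW kn] := leqP n k.
  by exists (k - n)%N; left; rewrite -{1}(subnKC nk) expgnDr mulKg.
by exists (n - k)%N; right; rewrite -{1}(subnKC kn) expgnDr invgM mulgVK.
Qed.

Lemma closed_cyclic_subgroup_mulVX a c (n : nat) :
  closed_cyclic_subgroup a c -> closed_cyclic_subgroup a (a ^- n * c).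
Proof.
move=> Cc B /(mulgl_continuous (a ^- n) c)/Cc[x [ax Bx]].
by exists (a ^- n * x); split => //; exact: cyclic_subgroup_mulVX.
Qed.

(** Some [x] in the cyclic group is so close to [c] that [x^-1 * c] is in [U]. Recurrence brings
    [a ^+ m] and [a ^- m] so close to [1] that multiplying by either stays in [U]. For [m > k] the
    factors [a ^+ m * x^-1] and [a ^- m * x^-1] are powers of [a] of opposite signs. *)
Lemma recurrent_closure a c U : recurrent a ->
  closed_cyclic_subgroup a c -> open U -> U 1 ->
  (exists n : nat, U (a ^- n * c)) /\
  (exists2 n : nat, (0 < n)%N & U (a ^+ n * c)).
Proof.
move=> reca Cc oU U1.
have : nbhs c ((fun x => x^-1 * c) @^-1` U).
  have : (fun x : G => x^-1 * c) @ c --> c^-1 * c.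
    by apply: cvgMg; [exact: invg_continuous|exact: cvg_cst].
  by apply; rewrite mulVg; exact: open_nbhs_nbhs.
move=> /Cc[x [/cyclic_subgroup_shift[k xk] /= Uxc]].
have V1 : nbhs 1 ((fun y => y * (x^-1 * c)) @^-1` U).
  by apply: mulgr_continuous; rewrite mul1g; exact: open_nbhs_nbhs.
have V1' : nbhs 1 ((fun y : G => y^-1) @^-1`
    ((fun y => y * (x^-1 * c)) @^-1` U)).
  by apply: invg_continuous; rewrite invg1.
have [m km [/= Um Um']] := reca _ (filterI V1 V1') k.
have [[i mi ei] [j mj ej]] := xk _ (ltnW km).
rewrite mulgA ei in Um; rewrite mulgA ej in Um'.
split; first by exists j.
by exists i => //; rewrite (leq_trans _ mi) ?subn_gt0.
Qed.

Lemma recurrent_periodic a :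
  locally_compact [set: G] -> recurrent a -> periodic a.
Proof.
move=> lcG reca; set C := closed_cyclic_subgroup a.
have [W W1 cW] := (topologicalGroup_locally_compactP G).1 lcG 1.
pose U := interior W; have oU : open U := open_interior W.
have closedC : closed C by exact: closed_closure.
have : compact (W `&` C) by exact: compact_closedI.
rewrite topologicalGroup_compact_cover.
move=> /(_ _ [set n : nat | (0 < n)%N] (fun n => (fun y => a ^+ n * y) @^-1` U)).
case=> [n _|c [_ Cc]|D D0 WCD].
- by apply: open_comp => // y _; exact: mulgl_continuous.
- by have [_ [n n0 Un]] := recurrent_closure _ _ _ reca Cc oU W1; exists n.
pose N := (\max_(i <- finmap.enum_fset D) i)%N.
have cover c : C c -> exists2 n, (n < N.+1)%N & W (a ^- n * c).
  move=> Cc; have [exU _] := recurrent_closure _ _ _ reca Cc oU W1.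
  have exUb : exists n, `[< U (a ^- n * c) >].
    by case: exU => n Un; exists n; apply/asboolP.
  case: (ex_minnP exUb) => n /asboolP Un minn.
  exists n; last exact: interior_subset Un.
  (* The point [a ^- n * c] is in both [W] and [C], so the finite subcover [D] supplies a return
     time [i] with [0 < i <= N]. *)
  have [|i /= iD Ui] := WCD (a ^- n * c).
    split; first exact: interior_subset Un.
    exact: closed_cyclic_subgroup_mulVX.
  have i0 : (0 < i)%N by have := D0 _ iD; rewrite inE.
  have iN : (i <= N)%N by exact: leq_bigmax_seq.
  rewrite ltnS leqNgt; apply/negP => Nn.
  have lin : (i <= n)%N by rewrite (leq_trans iN) // ltnW.
  (* Since [a ^- (n - i) * c] equals [a ^+ i * (a ^- n * c)], it is in [U], and the minimality of
     [n] applies to [n - i]. *)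
  have : (n <= n - i)%N.
    apply: minn; apply/asboolP; move: Ui.
    by rewrite /= -{1}(subnK lin) expgnDr invgM -mulgA mulVKg.
  by rewrite leqNgt ltn_subrL i0 (leq_trans i0).
apply: (@subclosed_compact _ _
  (\bigcup_(n < N.+1) [set a ^+ n * y | y in W])) => //.
  rewrite bigcup_mkord; apply: bigsetU_compact => n _; apply: continuous_compact => //.
  by apply: continuous_subspaceT; exact: mulgl_continuous.
move=> c /cover[n nN Wn]; exists n => //=.
by exists (a ^- n * c); rewrite ?mulVKg.
Qed.

End TopologicalGroup.

Theorem theorem2p6 (G : topologicalGroupType)
    (G_first_countable : first_countable G)
    (G_locally_compact : locally_compact [set: G])
    (a : G) :
  aperiodic a <->
  (forall K : set G, compact K ->
    exists N : nat, forall n : nat, (N < n)%N ->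
      K `&` [set k * a ^+ n | k in K] = set0).
Proof.
split=> [apera K cK|escape pera]; last first.
  (* Take for [K] the closed cyclic subgroup: it contains [1] and every [a ^+ n], so it always meets
     its translate. *)
  have [N /(_ N.+1 (ltnSn N))] := escape _ pera.
  apply/eqP/set0P; exists (a ^+ N.+1); split.
    by apply: subset_closure; exists N.+1; left.
  exists 1; last by rewrite mul1g.
  by apply: subset_closure; exists 0%N; left.
apply: contrapT => meet; apply/apera/recurrent_periodic => //.
(* A point [x = k * a ^+ n] with [x] and [k] in [K] puts [a ^+ n = k^-1 * x] in the compact set of
   quotients. *)
apply: compact_frequently_recurrent (compact_mulVg _ _ cK) _ => N.
apply: contrapT => noN; apply: meet; exists N => n Nn.
rewrite -subset0 => x [Kx [k Kk kx]]; apply: noN; exists n => //.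
by exists (k, x) => //=; rewrite -kx mulKg.
Qed.
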